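(* Let $x,y\in X$ satisfy $1<\partial(x,y)<k$ and write $i=\partial(x,y)$. The matrix of inner products of the vectors $\widehat{x},\widehat{y},\widehat{x\cap y},\widehat{x+y}$ (rows and columns indexed in this order, the $(u,v)$-entry being $\langle u,v\rangle$) is $$\begin{pmatrix} q^k[k][n-k] & [n][k-i]-[k]^2 & q^k[k-i][n-k] & q^{k+i}[k][n-k-i]\\ [n][k-i]-[k]^2 & q^k[k][n-k] & q^k[k-i][n-k] & q^{k+i}[k][n-k-i]\\ q^k[k-i][n-k] & q^k[k-i][n-k] & q^{k-i}[k-i][n-k+i] & q^{k+i}[k-i][n-k-i]\\ q^{k+i}[k][n-k-i] & q^{k+i}[k][n-k-i] & q^{k+i}[k-i][n-k-i] & q^{k+i}[k+i][n-k-i] \end{pmatrix}.$$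
   Context: Let $\mathbb{F}_q$ be a finite field with $q$ elements, let $n,k$ be integers with $n>2k\geq 6$, and let $V$ be an $n$-dimensional vector space over $\mathbb{F}_q$. For $m\in\mathbb{Z}$ write $[m]=(q^m-1)/(q-1)$. Let $P$ be the set of all subspaces of $V$ and $P_\ell$ the set of $\ell$-dimensional subspaces; put $X=P_k$. The Grassmann graph $\Gamma=J_q(n,k)$ has vertex set $X$, with $x,y\in X$ adjacent iff $\dim(x\cap y)=k-1$; $\partial$ is its path-length distance. Let $E$ be a (real) Euclidean space of dimension $[n]-1$ with inner product $\langle\,,\,\rangle$, and let $P_1\to E$, $s\mapsto\widehat{s}$ be a map such that: $E=\mathrm{Span}\{\widehat{s}\mid s\in P_1\}$; $\|\widehat{s}\|^2=[n]-1$ for $s\in P_1$; $\langle\widehat{s},\widehat{t}\rangle=-1$ for distinct $s,t\in P_1$; and $\sum_{s\in P_1}\widehat{s}=0$. For $u\in P$ define $\widehat{u}=\sum_{s\in P_1,\,s\subseteq u}\widehat{s}$. *)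

(* Defs.v *)
From HB Require Import structures.
From mathcomp Require Import all_boot all_order all_algebra.
From mathcomp Require Import reals.

Set Implicit Arguments.
Unset Strict Implicit.
Unset Printing Implicit Defensive.

Import Order.TTheory GRing.Theory Num.Theory.
Local Open Scope ring_scope.

(* The library registers {vspace vT} as a subtype of the matrices over K only
   inside VectorInternalTheory; finiteness is inherited through it. *)
Import VectorInternalTheory.

HB.instance Definition _ (K : finFieldType) (vT : vectType K) :=
  [Countable of {vspace vT} by <:].
HB.instance Definition _ (K : finFieldType) (vT : vectType K) :=
  [Finite of {vspace vT} by <:].

Section Grassmannian.
Variables (K : finFieldType) (V : vectType K) (l : nat).

Record grassmannian := Grassmannian {
  grassmannian_val :> {vspace V};
  _ : \dim grassmannian_val == l
}.

HB.instance Definition _ := [isSub for grassmannian_val].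
HB.instance Definition _ := [Finite of grassmannian by <:].

End Grassmannian.

Arguments grassmannian {K} V l.

Section GraphDistance.
Variables (T : finType) (e : rel T).

Definition walk (d : nat) (x y : T) : bool :=
  [exists p : d.-tuple T, path e x p && (last x p == y)].

(* Least length of a walk from x to y.  A shortest walk has length < #|T|, so
   the search range is large enough; the value is #|T| when there is no walk. *)
Definition graph_dist (x y : T) : nat :=
  find (fun d => walk d x y) (iota 0 #|T|).

End GraphDistance.

(* dim (x :&: y) = k - 1, written without truncated subtraction. *)
Definition grassmann_adj (K : finFieldType) (V : vectType K) (k : nat) :
    rel (grassmannian V k) :=
  fun x y => (\dim (x :&: y)%VS).+1 == k.

Definition qint (R : fieldType) (q : R) (m : int) : R :=
  (q ^ m - 1) / (q - 1).

Definition hat_ext (K : finFieldType) (V : vectType K) (R : fieldType)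
    (E : vectType R) (hat : grassmannian V 1 -> E) (u : {vspace V}) : E :=
  \sum_(s : grassmannian V 1 | (s <= u)%VS) hat s.

Definition gram_mx (R : realType) (E : vectType R) (ip : {dot E for idfun})
    (m : nat) (v : m.-tuple E) : 'M[R]_m :=
  \matrix_(a, b) ip (tnth v a) (tnth v b).

Definition mx_of_rows (R : nzRingType) (m n : nat) (rows : seq (seq R)) :
    'M[R]_(m, n) :=
  \matrix_(a < m, b < n) nth 0 (nth [::] rows a) b.

(* Main.v *)
Require Import Defs.
From HB Require Import structures.
From mathcomp Require Import all_boot all_order all_algebra all_field.
From mathcomp Require Import reals zify.

Set Implicit Arguments.
Unset Strict Implicit.
Unset Printing Implicit Defensive.

Import Order.TTheory GRing.Theory Num.Theory.
Local Open Scope ring_scope.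

(** With q = #|F| and [m] = (q^m - 1) / (q - 1), every entry of the matrix is an
    instance of one formula: for all subspaces u and w of V,
      < u^, w^ > = [n] [dim (u :&: w)] - [dim u] [dim w].
    Indeed the hypotheses on the vectors s^ say that < s^, t^ > equals [n] - 1
    when s = t and -1 otherwise, so that summing over the points s of u and
    t of w gives [n] times the number of common points minus the number of all
    pairs (lemma [hat_ext_dot]); and a subspace of dimension m has [m] points,
    because each point owns q - 1 of the q^m - 1 nonzero vectors, and each
    nonzero vector spans exactly one point (lemma [card_points]).

    It remains to know the dimensions of x :&: y and x + y, that is, to compute
    the distance in the Grassmann graph: it is k - dim (x :&: y) (lemma
    [grassmann_distE]).  A step of a walk raises the dimension of the
    intersection with y by at most one ([path_dim_cap]), and as long as the walk
    has not reached y some step does raise it ([grassmann_adj_closer]).  Hence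
    dim (x :&: y) = k - i and dim (x + y) = k + i.

    When one of u, w contains the other, the identity
    [m] - [l] = q^l [m - l] ([qint_sub]) turns the formula into the products
    displayed in the matrix; this covers all pairs but (x, y) and (y, x). *)

(** * Dimension in a vector space *)

Section Subspaces.
Variables (F : fieldType) (V : vectType F).
Implicit Types (U W X : {vspace V}) (v : V).

Lemma dimv_add_line U v : v \notin U -> \dim (U + <[v]>)%VS = (\dim U).+1.
Proof.
move=> vU; have v0 : v != 0 by apply: contraNneq vU => ->; rewrite mem0v.
rewrite dimv_disjoint_sum ?dim_vline ?v0 ?addn1 //.
apply/eqP; rewrite -subv0; apply/subvP => w.
rewrite memv_cap => /andP [wU /vlineP [a def_w]].
rewrite memv0 def_w; have [-> | a0] := eqVneq a 0; first by rewrite scale0r.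
by case/negP: vU; rewrite -[v](scalerK a0) -def_w memvZ.
Qed.

Lemma subv_dim_interpolate W X m :
    (W <= X)%VS -> (\dim W <= m <= \dim X)%N ->
  exists H, [/\ (W <= H)%VS, (H <= X)%VS & \dim H = m].
Proof.
move=> sWX /andP []; elim: m => [|m IHm] le_Wm le_mX.
  by exists W; split => //; lia.
move: le_Wm; rewrite leq_eqVlt => /predU1P [eq_Wm | lt_Wm]; first by exists W.
have [H [sWH sHX dimH]] := IHm lt_Wm (ltnW le_mX).
have /subvPn [v vX vH] : ~~ (X <= H)%VS.
  by apply: contraL le_mX => /dimvS; rewrite dimH -ltnNge ltnS.
exists (H + <[v]>)%VS; split; last by rewrite dimv_add_line ?dimH.
  exact: subv_trans sWH (addvSl _ _).
by rewrite subv_add sHX -memvE.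
Qed.

End Subspaces.

(** * Distance in the Grassmann graph *)

(** The distance is defined by a search over lengths below #|T|.  The search
    finds the minimum because removing the loops of a walk leaves one with
    distinct vertices, so that a shortest walk is shorter than #|T|. *)
Lemma graph_dist_shortest (T : finType) (e : rel T) (x : T) (p : seq T) :
    path e x p ->
    (forall p', path e x p' -> last x p' = last x p -> (size p <= size p')%N) ->
  graph_dist e x (last x p) = size p.
Proof.
set y := last x p => path_p min_p.
have lt_pT : (size p < #|T|)%N.
  have [p' [path_p' uniq_p' last_p']] : exists p',
      [/\ path e x p', uniq (x :: p') & last x p' = y].
    by rewrite /y; case/shortenP: path_p => p' ? ? _; exists p'.
  apply: leq_ltn_trans (min_p p' path_p' last_p') _.
  by rewrite -[(size p').+1]/(size (x :: p')) -(card_uniqP uniq_p') max_card.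
have walk_p : walk e (size p) x y.
  by apply/existsP; exists (in_tuple p); rewrite path_p /=.
have has_walk : has (fun d => walk e d x y) (iota 0 #|T|).
  by apply/hasP; exists (size p); rewrite ?mem_iota.
have le_dp : (graph_dist e x y <= size p)%N.
  rewrite leqNgt; apply/negP => lt_pd.
  by have := before_find 0%N lt_pd; rewrite nth_iota // add0n walk_p.
apply/eqP; rewrite eqn_leq le_dp.
have := nth_find 0%N has_walk; rewrite nth_iota; last first.
  exact: leq_ltn_trans le_dp lt_pT.
case/existsP => p' /andP [path_p' /eqP last_p'].
by have := min_p p' path_p' last_p'; rewrite size_tuple.
Qed.

Section GrassmannDistance.
Variables (F : finFieldType) (V : vectType F) (k : nat).
Implicit Types (x y z : grassmannian V k).

Lemma grassmann_dim x : \dim x = k.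
Proof. by case: x => U /= /eqP. Qed.

(** If x and z are adjacent, x :&: z and z :&: y are subspaces of z, the first
    of codimension 1; so x :&: z :&: y has codimension at most 1 in z :&: y. *)
Lemma path_dim_cap x (p : seq (grassmannian V k)) :
  path (@grassmann_adj F V k) x p -> (k <= \dim (x :&: last x p)%VS + size p)%N.
Proof.
elim: p x => [|z p IHp] x /=; first by rewrite capvv grassmann_dim addn0.
case/andP => /eqP adj_xz /IHp; set y := last z p => le_zy.
have := dimv_sum_cap (x :&: z) (z :&: y)%VS.
have /dimvS : (x :&: z + z :&: y <= z)%VS by rewrite subv_add capvSr capvSl.
have /dimvS : ((x :&: z) :&: (z :&: y) <= x :&: y)%VS.
  by apply: capvS; [apply: capvSl | apply: capvSr].
by rewrite grassmann_dim; lia.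
Qed.

(** Exchange: keep a hyperplane H of x that contains x :&: y, and replace the
    rest of x by a vector v of y outside x, that is, take z = H + <[v]>.  Then
    x :&: z = H, while z :&: y contains both x :&: y and v. *)
Lemma grassmann_adj_closer x y : x != y ->
  exists2 z, grassmann_adj x z &
    (\dim (x :&: y)%VS < \dim (z :&: y)%VS)%N.
Proof.
move=> neq_xy.
have /subvPn [v vy vx] : ~~ (y <= x)%VS.
  apply: contra neq_xy => sxy; rewrite -val_eqE /= eq_sym.
  by rewrite -(geq_leqif (dimv_leqif_eq sxy)) !grassmann_dim.
have lt_k : (\dim (x :&: y)%VS < k)%N.
  rewrite -[X in (_ < X)%N](grassmann_dim y) ltn_neqAle dimvS ?capvSr // andbT.
  rewrite (dimv_leqif_eq (capvSr x y)); apply: contraNneq vx => eq_y.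
  by move: vy; rewrite -eq_y memv_cap => /andP [].
have [||H [sWH sHx dimH]] := @subv_dim_interpolate _ _ (x :&: y)%VS x k.-1.
- exact: capvSl.
- by rewrite grassmann_dim; lia.
have vH : v \notin H by apply: contra vx => /(subvP sHx).
have dim_z : \dim (H + <[v]>)%VS == k by rewrite dimv_add_line // dimH; lia.
exists (Grassmannian dim_z); rewrite /grassmann_adj /=.
  have : (H <= x :&: (H + <[v]>))%VS by rewrite subv_cap sHx addvSl.
  move/dimvS; have := dimvS (capvSl x (H + <[v]>)%VS).
  have := dimvS (capvSr x (H + <[v]>)%VS).
  rewrite dimH (eqP dim_z) grassmann_dim => _ le1 le2.
  (* Otherwise z = x, and x would contain v. *)
  suff : \dim (x :&: (H + <[v]>)%VS) != k by lia.
  apply: contraNneq vx => dim_cap.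
  have : (x :&: (H + <[v]>))%VS == (H + <[v]>)%VS.
    by rewrite -(dimv_leqif_eq (capvSr _ _)) dim_cap (eqP dim_z).
  by move/eqP/capv_idPr; rewrite subv_add -memvE => /andP [].
have vW : v \notin (x :&: y)%VS by rewrite memv_cap (negPf vx).
rewrite -(dimv_add_line vW) dimvS // subv_cap addvS //=.
by rewrite subv_add capvSr -memvE.
Qed.

Lemma grassmann_path x y d : (k <= \dim (x :&: y)%VS + d)%N ->
  exists p, [/\ path (@grassmann_adj F V k) x p, last x p = y & (size p <= d)%N].
Proof.
elim: d x => [|d IHd] x le_kd; have [<-|neq_xy] := eqVneq x y;
  try by exists [::].
- (* No steps left: a closer vertex would meet y in more than k dimensions. *)
  have [z _ lt_xz] := grassmann_adj_closer neq_xy.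
  by have := dimvS (capvSl z y); rewrite grassmann_dim; lia.
have [z adj_xz lt_xz] := grassmann_adj_closer neq_xy.
have [|p [path_p last_p size_p]] := IHd z; first by lia.
by exists (z :: p); rewrite /= adj_xz.
Qed.

Lemma grassmann_distE x y :
  (graph_dist (@grassmann_adj F V k) x y + \dim (x :&: y)%VS)%N = k.
Proof.
have le_ck : (\dim (x :&: y)%VS <= k)%N.
  by rewrite -[X in (_ <= X)%N](grassmann_dim x) dimvS ?capvSl.
have [|p [path_p last_p size_p]] := @grassmann_path x y (k - \dim (x :&: y)%VS).
  by rewrite subnKC.
rewrite -{1}last_p graph_dist_shortest // => [|p' path_p' last_p'].
  apply/eqP; rewrite eqn_leq -[X in (_ <= X)%N](subnK le_ck) leq_add2r size_p addnC.
  by have := path_dim_cap path_p; rewrite last_p.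
have := path_dim_cap path_p'; rewrite last_p' last_p -leq_subLR.
exact: leq_trans.
Qed.

End GrassmannDistance.

(** * Points of a subspace and inner products *)

Section PointCount.
Variables (F : finFieldType).

Lemma point_vline (V : vectType F) (s : grassmannian V 1) (v : V) :
  v != 0 -> v \in (s : {vspace V}) -> s == <[v]>%VS :> {vspace V}.
Proof.
move=> v0 vs; rewrite eq_sym -(dimv_leqif_eq (U := <[v]>%VS)) -?memvE //.
by rewrite dim_vline v0 grassmann_dim.
Qed.

(** Double count of the pairs (s, v) with v a nonzero vector of the point s of
    u.  The count ranges over the vectors, so V is taken with an underlying
    finite type; the equality test on vectors is then the one of T, which need
    not be convertible to the one of the vector space structure. *)
Lemma card_points_fin (T : finType) (cvT : Vector F T) (V := Vector.Pack cvT)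
    (u : {vspace V}) :
  (#|[pred s : grassmannian V 1 | (s <= u)%VS]| * #|F|.-1)%N
    = (#|F| ^ \dim u).-1.
Proof.
have cardN0 (w : {vspace V}) :
    #|[pred v : T | (v != (0 : V)) && (v \in w)]| = (#|F| ^ \dim w).-1.
  have := cardD1 (0 : V) w; rewrite -card_vspace => ->.
  have -> : (0 : V) \in w by exact: mem0v.
  rewrite add1n /=.
  apply: eq_card => v.
  by rewrite !inE.
rewrite -(cardN0 u) -sum_nat_const -[RHS]sum1_card.
transitivity (\sum_(s : grassmannian V 1 | (s <= u)%VS)
   \sum_(v : T | (v != (0%R : V)) && (v \in (s : {vspace V}))) 1)%N.
  by apply: eq_bigr => s _; rewrite sum1_card cardN0 grassmann_dim expn1.
rewrite (exchange_big_dep [pred v : T | (v != (0 : V)) && (v \in u)]) /=; last first.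
  by move=> s v su /andP [-> /(subvP su)].
apply: eq_bigr => v /andP [v0 vu].
have vN0 : (v : V) != 0 by apply/eqP => v_eq0; case/eqP: v0.
have dim_v : \dim <[v : V]>%VS == 1%N by rewrite dim_vline vN0.
rewrite (big_pred1 (Grassmannian dim_v)) // => s /=.
rewrite v0 -val_eqE /=; apply/andP/idP => [[_ vs]|/eqP ->].
  exact: point_vline.
by split=> //; exact: memv_line.
Qed.

(** Any vector space over a finite field becomes finite under the alias
    [finvect_type], which leaves its subspaces unchanged. *)
Lemma card_points (V : vectType F) (u : {vspace V}) :
  (#|[pred s : grassmannian V 1 | (s <= u)%VS]| * #|F|.-1)%N
    = (#|F| ^ \dim u).-1.
Proof.
case: V u => T cvT u.
exact: (@card_points_fin (finvect_type (Vector.Pack cvT)) cvT).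
Qed.

Lemma card_points_qint (V : vectType F) (R : numFieldType)
    (u : {vspace V}) :
  #|[pred s : grassmannian V 1 | (s <= u)%VS]|%:R = qint (#|F|%:R : R) (\dim u).
Proof.
have F1 := card_finRing_gt1 F.
have q1 : #|F|%:R - 1 != 0 :> R by rewrite subr_eq0 pnatr_eq1 neq_ltn F1 orbT.
apply: (mulIf q1); rewrite /qint divfK // -exprnP -natrX.
have predR m : (0 < m)%N -> m%:R - 1 = m.-1%:R :> R.
  by case: m => // m _; rewrite -natr1 addrK.
by rewrite !predR ?expn_gt0 ?(ltnW F1) // -natrM card_points.
Qed.

End PointCount.

(** The points common to u and w are the points of u :&: w; they are the pairs
    (s, s) of the double sum, each contributing c more than the other pairs. *)
Lemma hat_ext_dot (R : realType) (F : finFieldType) (V : vectType F)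
    (E : vectType R) (ip : {dot E for idfun}) (hat : grassmannian V 1 -> E)
    (c : R)
    (hnorm : forall s, ip (hat s) (hat s) = c - 1)
    (hip : forall s t, s <> t -> ip (hat s) (hat t) = -1) (u w : {vspace V}) :
  let b := qint (#|F|%:R : R) in
  ip (hat_ext hat u) (hat_ext hat w) =
    c * b (\dim (u :&: w)%VS) - b (\dim u) * b (\dim w).
Proof.
have ipE s t : ip (hat s) (hat t) = c * (s == t)%:R - 1.
  by case: eqVneq => [->|/eqP/hip->]; rewrite ?hnorm ?mulr1 ?mulr0 ?sub0r.
move=> b.
have ip_hat s : ip (hat s) (hat_ext hat w) = c * (s <= w)%VS%:R - b (\dim w).
  rewrite /hat_ext linear_sumr (eq_bigr _ (fun t _ => ipE s t)).
  rewrite sumrB -mulr_sumr sumr_const card_points_qint; congr (c * _ - _).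
  rewrite big_mkcond (bigD1 s) //= eqxx big1 ?addr0; first by case: ifP.
  by move=> t ts; rewrite eq_sym (negPf ts) if_same.
rewrite {1}/hat_ext linear_sumlz (eq_bigr _ (fun s _ => ip_hat s)).
rewrite sumrB -mulr_sumr sumr_const -[_ *+ _]mulr_natl card_points_qint.
congr (c * _ - _); rewrite /b -card_points_qint -sumr_const.
rewrite big_mkcond [RHS]big_mkcond; apply: eq_bigr => s _.
by rewrite !inE subv_cap; do 2!case: (_ <= _)%VS.
Qed.

Lemma qint_sub (R : fieldType) (q : R) (m l : int) :
  q != 0 -> qint q m - qint q l = q ^ l * qint q (m - l).
Proof.
move=> q0; rewrite /qint -mulrBl mulrA mulrBr mulr1 -expfzDr //.
by rewrite [l + _]addrC subrK opprB addrA subrK.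
Qed.

Theorem theorem10p4
  (R : realType) (F : finFieldType) (V : vectType F) (n k : nat)
  (hn : \dim {:V} = n) (hkn : (2 * k < n)%N) (hk : (6 <= 2 * k)%N)
  (E : vectType R) (ip : {dot E for idfun})
  (hdimE : (\dim {:E})%:R = qint (#|F|%:R : R) n - 1)
  (hat : grassmannian V 1 -> E)
  (hspan : <<codom hat>>%VS = {:E}%VS)
  (hnorm : forall s, ip (hat s) (hat s) = qint #|F|%:R n - 1)
  (hip : forall s t, s <> t -> ip (hat s) (hat t) = -1)
  (hsum : \sum_s hat s = 0)
  (x y : grassmannian V k) (i : nat)
  (hi : i = graph_dist (@grassmann_adj F V k) x y) (hik : (1 < i < k)%N) :
  let q : R := #|F|%:R in
  let b : int -> R := qint q in
  gram_mx ip [tuple hat_ext hat x; hat_ext hat y;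
                    hat_ext hat (x :&: y)%VS; hat_ext hat (x + y)%VS]
  = mx_of_rows 4 4
  [:: [:: q ^ k * b k * b (n%:Z - k%:Z);
          b n * b (k%:Z - i%:Z) - b k ^+ 2;
          q ^ k * b (k%:Z - i%:Z) * b (n%:Z - k%:Z);
          q ^ (k%:Z + i%:Z) * b k * b (n%:Z - k%:Z - i%:Z)];
      [:: b n * b (k%:Z - i%:Z) - b k ^+ 2;
          q ^ k * b k * b (n%:Z - k%:Z);
          q ^ k * b (k%:Z - i%:Z) * b (n%:Z - k%:Z);
          q ^ (k%:Z + i%:Z) * b k * b (n%:Z - k%:Z - i%:Z)];
      [:: q ^ k * b (k%:Z - i%:Z) * b (n%:Z - k%:Z);
          q ^ k * b (k%:Z - i%:Z) * b (n%:Z - k%:Z);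
          q ^ (k%:Z - i%:Z) * b (k%:Z - i%:Z) * b (n%:Z - k%:Z + i%:Z);
          q ^ (k%:Z + i%:Z) * b (k%:Z - i%:Z) * b (n%:Z - k%:Z - i%:Z)];
      [:: q ^ (k%:Z + i%:Z) * b k * b (n%:Z - k%:Z - i%:Z);
          q ^ (k%:Z + i%:Z) * b k * b (n%:Z - k%:Z - i%:Z);
          q ^ (k%:Z + i%:Z) * b (k%:Z - i%:Z) * b (n%:Z - k%:Z - i%:Z);
          q ^ (k%:Z + i%:Z) * b (k%:Z + i%:Z) * b (n%:Z - k%:Z - i%:Z)]].

Proof.
move=> q b.
have F1 := card_finRing_gt1 F.
have q0 : q != 0 by rewrite pnatr_eq0 -lt0n ltnW.
have dim_cap : (\dim (x :&: y)%VS)%:Z = k%:Z - i%:Z.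
  apply: (addrI i%:Z); rewrite subrKC -PoszD; congr Posz.
  by rewrite [RHS](esym (grassmann_distE x y)) -hi.
have dim_capC : (\dim (y :&: x)%VS)%:Z = k%:Z - i%:Z by rewrite capvC.
have dim_add : (\dim (x + y)%VS)%:Z = k%:Z + i%:Z.
  have := dimv_sum_cap x y; rewrite !grassmann_dim => /(congr1 Posz).
  rewrite !PoszD dim_cap => eq_dim; apply: (addIr (k%:Z - i%:Z)).
  by rewrite eq_dim addrACA subrr addr0.
have ipE u w (c du dw : int) :
    (\dim (u :&: w)%VS)%:Z = c -> (\dim u)%:Z = du -> (\dim w)%:Z = dw ->
  ip (hat_ext hat u) (hat_ext hat w) = b n * b c - b du * b dw.
  by move=> <- <- <-; exact: hat_ext_dot.
have ip_sub u w (du dw : int) : (u <= w)%VS ->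
    (\dim u)%:Z = du -> (\dim w)%:Z = dw ->
  ip (hat_ext hat u) (hat_ext hat w) = q ^ dw * b du * b (n%:Z - dw).
  move=> /capv_idPl suw eq_u eq_w; rewrite (@ipE _ _ du du dw) ?suw //.
  by rewrite mulrC -mulrBr qint_sub // mulrCA mulrA.
have ip_sub' u w (du dw : int) : (u <= w)%VS ->
    (\dim u)%:Z = du -> (\dim w)%:Z = dw ->
  ip (hat_ext hat w) (hat_ext hat u) = q ^ dw * b du * b (n%:Z - dw).
  move=> /capv_idPr suw eq_u eq_w; rewrite (@ipE _ _ du dw du) ?suw //.
  by rewrite -mulrBl qint_sub // mulrAC.
have dim_x : (\dim x)%:Z = k by rewrite grassmann_dim.
have dim_y : (\dim y)%:Z = k by rewrite grassmann_dim.
have sub_x := capvSl x y; have sub_y := capvSr x y.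
have sub_xD := addvSl x y; have sub_yD := addvSr x y.
have sub_capD := subv_trans sub_x sub_xD.
apply/matrixP => -[[|[|[|[|//]]]] lt_r] [[|[|[|[|//]]]] lt_c];
  rewrite !mxE !(tnth_nth 0) /=.
- exact: (ip_sub _ _ _ _ (subvv _) dim_x dim_x).
- by rewrite (ipE _ _ _ _ _ dim_cap dim_x dim_y) expr2.
- exact: (ip_sub' _ _ _ _ sub_x dim_cap dim_x).
- by rewrite (ip_sub _ _ _ _ sub_xD dim_x dim_add) opprD addrA.
- by rewrite (ipE _ _ _ _ _ dim_capC dim_y dim_x) expr2.
- exact: (ip_sub _ _ _ _ (subvv _) dim_y dim_y).
- exact: (ip_sub' _ _ _ _ sub_y dim_cap dim_y).
- by rewrite (ip_sub _ _ _ _ sub_yD dim_y dim_add) opprD addrA.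
- exact: (ip_sub _ _ _ _ sub_x dim_cap dim_x).
- exact: (ip_sub _ _ _ _ sub_y dim_cap dim_y).
- by rewrite (ip_sub _ _ _ _ (subvv _) dim_cap dim_cap) opprB addrA addrAC.
- by rewrite (ip_sub _ _ _ _ sub_capD dim_cap dim_add) opprD addrA.
- by rewrite (ip_sub' _ _ _ _ sub_xD dim_x dim_add) opprD addrA.
- by rewrite (ip_sub' _ _ _ _ sub_yD dim_y dim_add) opprD addrA.
- by rewrite (ip_sub' _ _ _ _ sub_capD dim_cap dim_add) opprD addrA.
- by rewrite (ip_sub _ _ _ _ (subvv _) dim_add dim_add) opprD addrA.
Qed.
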